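(* Let $f_1,f_2$ be nowhere zero smooth real-valued functions on $\mathbb{R}^2$, both depending only on $x^1$ (written $f_i=f_i(x^1)$), and suppose $f_2'(x^1)\neq 0$ for all $x^1\in\mathbb{R}$. Endow $\mathbb{R}^2$ with the Riemannian metric $g=\frac{1}{f_1^2}dx^1\otimes dx^1+\frac{1}{f_2^2}dx^2\otimes dx^2$ and let $E_1=f_1\frac{\partial}{\partial x^1}$, $E_2=f_2\frac{\partial}{\partial x^2}$. Let $V=V^1E_1+V^2E_2$ with $V^1,V^2$ smooth real-valued functions on $\mathbb{R}^2$. Then $V$ is a Ricci vector field satisfying $\nabla V=Q$ if and only if (i) $$V^1(x^1)=\frac{c}{f_2(x^1)},\qquad V^2=0,\qquad\text{and}\qquad f_1=\frac{kf_2^2+c}{2f_2'},$$ or (ii) $$V^1(x^2)=\operatorname{sign}(c)\left[c_2\cos(|c|x^2)-c_1\sin(|c|x^2)\right],\qquad V^2(x^2)=c_1\cos(|c|x^2)+c_2\sin(|c|x^2),$$ and $f_1=c\,\dfrac{f_2^2}{f_2'}$, with $k,c\in\mathbb{R}\setminus\{0\}$ and $c_1,c_2\in\mathbb{R}$ constants.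
   Context: $x^1,x^2$ are the standard coordinates on $\mathbb{R}^2$; a prime denotes the derivative with respect to $x^1$. When a function on $\mathbb{R}^2$ depends on only one of the variables, only that variable is written in its argument (so $V^1(x^1)$ means that $V^1$ depends only on $x^1$, and $V^i(x^2)$ that $V^i$ depends only on $x^2$). $\nabla$ denotes the Levi-Civita connection of $g$, $\mathrm{Ric}$ its Ricci curvature tensor field, and $Q$ the Ricci operator defined by $g(QX_1,X_2)=\mathrm{Ric}(X_1,X_2)$ for all smooth vector fields $X_1,X_2$ on $\mathbb{R}^2$. A smooth vector field $V$ is a Ricci vector field satisfying $\nabla V=Q$ if $\nabla_XV=QX$ for all smooth vector fields $X$ on $\mathbb{R}^2$.
   Formalization: In (i) the constant k may be any real number, zero included; with k nonzero the ''only if'' fails, e.g. f_1=e^{-x^1}/2, f_2=e^{x^1}, V^1=e^{-x^1}, V^2=0 satisfies ∇V=Q but forces k=0, c=1. *)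

(* Defs.v *)
From Stdlib Require Import Reals.
From Coquelicot Require Import Coquelicot.
Open Scope R_scope.

Definition scalar_field : Type := R -> R -> R.

(* [ex_diff_n f n x y] bundles existence and continuity at (x, y) of all iterated
   partial derivatives of [f] of order at most [n]. *)
Definition smooth (f : scalar_field) : Prop :=
  forall (n : nat) (x y : R), ex_diff_n f n x y.

Definition D1 (f : scalar_field) : scalar_field :=
  fun x y => Derive (fun t => f t y) x.

Definition D2 (f : scalar_field) : scalar_field :=
  fun x y => Derive (fun t => f x t) y.

Definition only_x1 (f : scalar_field) : Prop :=
  forall x y y' : R, f x y = f x y'.

(* The pair (a, b) stands for the vector field a d/dx^1 + b d/dx^2. *)
Definition vector_field : Type := (scalar_field * scalar_field)%type.

Definition smooth_vf (X : vector_field) : Prop :=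
  smooth (fst X) /\ smooth (snd X).

Definition dx1 (X : vector_field) : scalar_field := fst X.
Definition dx2 (X : vector_field) : scalar_field := snd X.

Definition d1 : vector_field := (fun _ _ => 1, fun _ _ => 0).
Definition d2 : vector_field := (fun _ _ => 0, fun _ _ => 1).

Definition vadd (X Y : vector_field) : vector_field :=
  (fun x y => dx1 X x y + dx1 Y x y, fun x y => dx2 X x y + dx2 Y x y).

Definition vsub (X Y : vector_field) : vector_field :=
  (fun x y => dx1 X x y - dx1 Y x y, fun x y => dx2 X x y - dx2 Y x y).

Definition vscal (f : scalar_field) (X : vector_field) : vector_field :=
  (fun x y => f x y * dx1 X x y, fun x y => f x y * dx2 X x y).

Definition deriv_along (X : vector_field) (f : scalar_field) : scalar_field :=
  fun x y => dx1 X x y * D1 f x y + dx2 X x y * D2 f x y.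

Definition lie_bracket (X Y : vector_field) : vector_field :=
  (fun x y => deriv_along X (dx1 Y) x y - deriv_along Y (dx1 X) x y,
   fun x y => deriv_along X (dx2 Y) x y - deriv_along Y (dx2 X) x y).

Definition metric (f1 f2 : scalar_field) (X Y : vector_field) : scalar_field :=
  fun x y => 1 / f1 x y ^ 2 * (dx1 X x y * dx1 Y x y)
           + 1 / f2 x y ^ 2 * (dx2 X x y * dx2 Y x y).

Record is_affine_connection
    (nabla : vector_field -> vector_field -> vector_field) : Prop := {
  connection_smooth : forall X Y,
    smooth_vf X -> smooth_vf Y -> smooth_vf (nabla X Y);
  connection_addl : forall X X' Y,
    smooth_vf X -> smooth_vf X' -> smooth_vf Y ->
    nabla (vadd X X') Y = vadd (nabla X Y) (nabla X' Y);
  connection_scall : forall f X Y,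
    smooth f -> smooth_vf X -> smooth_vf Y ->
    nabla (vscal f X) Y = vscal f (nabla X Y);
  connection_addr : forall X Y Y',
    smooth_vf X -> smooth_vf Y -> smooth_vf Y' ->
    nabla X (vadd Y Y') = vadd (nabla X Y) (nabla X Y');
  connection_leibniz : forall f X Y,
    smooth f -> smooth_vf X -> smooth_vf Y ->
    nabla X (vscal f Y) = vadd (vscal (deriv_along X f) Y) (vscal f (nabla X Y))
}.

Record is_levi_civita
    (g : vector_field -> vector_field -> scalar_field)
    (nabla : vector_field -> vector_field -> vector_field) : Prop := {
  levi_civita_affine : is_affine_connection nabla;
  levi_civita_torsion_free : forall X Y,
    smooth_vf X -> smooth_vf Y ->
    vsub (nabla X Y) (nabla Y X) = lie_bracket X Y;
  levi_civita_metric : forall X Y Z,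
    smooth_vf X -> smooth_vf Y -> smooth_vf Z ->
    deriv_along X (g Y Z)
    = (fun x y => g (nabla X Y) Z x y + g Y (nabla X Z) x y)
}.

Definition curvature
    (nabla : vector_field -> vector_field -> vector_field)
    (X Y Z : vector_field) : vector_field :=
  vsub (vsub (nabla X (nabla Y Z)) (nabla Y (nabla X Z)))
       (nabla (lie_bracket X Y) Z).

(* Ric(Y, Z) = trace (X |-> R(X, Y) Z), so that round spheres have positive
   Ricci curvature. *)
Definition ricci
    (nabla : vector_field -> vector_field -> vector_field)
    (Y Z : vector_field) : scalar_field :=
  fun x y => dx1 (curvature nabla d1 Y Z) x y + dx2 (curvature nabla d2 Y Z) x y.

Definition is_ricci_operator
    (g : vector_field -> vector_field -> scalar_field)
    (nabla : vector_field -> vector_field -> vector_field)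
    (Q : vector_field -> vector_field) : Prop :=
  forall X, smooth_vf X ->
    smooth_vf (Q X) /\
    forall Y, smooth_vf Y -> g (Q X) Y = ricci nabla X Y.

Definition is_ricci_vector_field
    (nabla : vector_field -> vector_field -> vector_field)
    (Q : vector_field -> vector_field) (V : vector_field) : Prop :=
  smooth_vf V /\ forall X, smooth_vf X -> nabla X V = Q X.

Definition frame1 (f1 : scalar_field) : vector_field := vscal f1 d1.
Definition frame2 (f2 : scalar_field) : vector_field := vscal f2 d2.

(* The constant k is allowed to vanish: with f1 = exp(-x)/2, f2 = exp(x) and
   V = exp(-x) E1 one has nabla V = Q, and f1 = (k f2^2 + c) / (2 f2') holds for
   k = 0, c = 1 only. *)
Definition radial_case (f1 f2 V1 V2 : scalar_field) (k c : R) : Prop :=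
  (forall x y, V1 x y = c / f2 x y) /\
  (forall x y, V2 x y = 0) /\
  (forall x y, f1 x y = (k * f2 x y ^ 2 + c) / (2 * D1 f2 x y)).

Definition flat_case (f1 f2 V1 V2 : scalar_field) (c c1 c2 : R) : Prop :=
  (forall x y, V1 x y
     = sign c * (c2 * cos (Rabs c * y) - c1 * sin (Rabs c * y))) /\
  (forall x y, V2 x y = c1 * cos (Rabs c * y) + c2 * sin (Rabs c * y)) /\
  (forall x y, f1 x y = c * (f2 x y ^ 2 / D1 f2 x y)).

(* Main.v *)
From Stdlib Require Import Reals FunctionalExtensionality Classical Lra.
From Coquelicot Require Import Coquelicot.
Require Import Defs.
Open Scope R_scope.

(** Put p = f1 f2' / f2^2. In the coordinate frame the Christoffel symbols are
explicit, and the Ricci operator turns out to be multiplication by the Gauss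
curvature f1 f2 p'. Hence nabla V = Q is equivalent to the first-order system
  d_1 V^1 = f2 p',  d_2 V^1 = - p V^2,  d_1 V^2 = 0,  d_2 V^2 = p V^1 + f1 p'.
Equality of the mixed derivatives of V^1 gives p' V^2 = 0. If V^2 = 0, then
V^1 f2 is a constant c and 2 p - c / f2^2 is a constant k, which is the radial
case (for c = 0 it is the zero field of a flat metric, hence an instance of the
flat case). Otherwise p is a nonzero constant c, the curvature vanishes, and
(V^1, V^2) depends on x^2 only and rotates with angular velocity c. *)

(** * Smooth functions of two variables and their partial derivatives *)

Lemma scalar_field_ext (f g : scalar_field) : (forall x y, f x y = g x y) -> f = g.
Proof.
intros fg. apply functional_extensionality; intro x.
apply functional_extensionality; intro y. apply fg.
Qed.

(* Closed under [D1] and [D2], so that its members are smooth by induction on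
   the order of differentiation. *)
Inductive smooth_closure : scalar_field -> Prop :=
| closure_smooth f : smooth f -> smooth_closure f
| closure_const c : smooth_closure (fun _ _ => c)
| closure_plus f g : smooth_closure f -> smooth_closure g ->
    smooth_closure (fun x y => f x y + g x y)
| closure_mult f g : smooth_closure f -> smooth_closure g ->
    smooth_closure (fun x y => f x y * g x y)
| closure_inv f : smooth_closure f -> (forall x y, f x y <> 0) ->
    smooth_closure (fun x y => / f x y).

(** What [ex_diff_n] asks of a function itself before it passes to the partial derivatives. *)
Definition differentiable_along_axes (f : scalar_field) : Prop :=
  forall x y, continuity_2d_pt f x y /\
    ex_derive (fun t => f t y) x /\ ex_derive (fun t => f x t) y.

Lemma smooth_differentiable f : smooth f -> differentiable_along_axes f.
Proof.
intros sf x y. split; [apply (sf 0%nat x y)|split; apply (sf 1%nat x y)].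
Qed.

Lemma differentiable_ex_D1 f x y :
  differentiable_along_axes f -> ex_derive (fun t => f t y) x.
Proof. intros df. exact (proj1 (proj2 (df x y))). Qed.

Lemma differentiable_ex_D2 f x y :
  differentiable_along_axes f -> ex_derive (fun t => f x t) y.
Proof. intros df. exact (proj2 (proj2 (df x y))). Qed.

Ltac derivative :=
  intros; unfold D1, D2; apply is_derive_unique; auto_derive;
  [ repeat match goal with |- _ /\ _ => split end;
    auto using differentiable_ex_D1, differentiable_ex_D2
  | try ring ].

Lemma D1_const c x y : D1 (fun _ _ => c) x y = 0.
Proof. derivative. Qed.

Lemma D2_const c x y : D2 (fun _ _ => c) x y = 0.
Proof. derivative. Qed.

Lemma D1_plus f g x y :
  differentiable_along_axes f -> differentiable_along_axes g ->
  D1 (fun x y => f x y + g x y) x y = D1 f x y + D1 g x y.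
Proof. derivative. Qed.

Lemma D2_plus f g x y :
  differentiable_along_axes f -> differentiable_along_axes g ->
  D2 (fun x y => f x y + g x y) x y = D2 f x y + D2 g x y.
Proof. derivative. Qed.

Lemma D1_mult f g x y :
  differentiable_along_axes f -> differentiable_along_axes g ->
  D1 (fun x y => f x y * g x y) x y = D1 f x y * g x y + f x y * D1 g x y.
Proof. derivative. Qed.

Lemma D2_mult f g x y :
  differentiable_along_axes f -> differentiable_along_axes g ->
  D2 (fun x y => f x y * g x y) x y = D2 f x y * g x y + f x y * D2 g x y.
Proof. derivative. Qed.

(** The right-hand side is put together from constants, products and inverses only, so that it
    visibly lies in [smooth_closure]. *)
Lemma D1_inv f x y : differentiable_along_axes f -> f x y <> 0 ->
  D1 (fun x y => / f x y) x y = -1 * D1 f x y * (/ f x y * / f x y).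
Proof. derivative. unfold D1. now field. Qed.

Lemma D2_inv f x y : differentiable_along_axes f -> f x y <> 0 ->
  D2 (fun x y => / f x y) x y = -1 * D2 f x y * (/ f x y * / f x y).
Proof. derivative. unfold D2. now field. Qed.

Lemma smooth_closure_step f : smooth_closure f ->
  differentiable_along_axes f /\ smooth_closure (D1 f) /\ smooth_closure (D2 f).
Proof.
induction 1 as [f sf|c|f g cf [df [cf1 cf2]] cg [dg [cg1 cg2]]
  |f g cf [df [cf1 cf2]] cg [dg [cg1 cg2]]|f cf [df [cf1 cf2]] f_neq0].
- split; [now apply smooth_differentiable|].
  split; apply closure_smooth; intros n x y; apply (sf (S n) x y).
- rewrite (scalar_field_ext _ _ (D1_const c)), (scalar_field_ext _ _ (D2_const c)).
  split; [|split; apply closure_const].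
  intros x y. split; [apply continuity_2d_pt_const|split; auto_derive; auto].
- rewrite (scalar_field_ext _ _ (fun u v => D1_plus f g u v df dg)),
    (scalar_field_ext _ _ (fun u v => D2_plus f g u v df dg)).
  split; [|split; now apply closure_plus].
  intros x y. destruct (df x y) as [? []], (dg x y) as [? []].
  split; [now apply continuity_2d_pt_plus|split; auto_derive; auto].
- rewrite (scalar_field_ext _ _ (fun u v => D1_mult f g u v df dg)),
    (scalar_field_ext _ _ (fun u v => D2_mult f g u v df dg)).
  split; [|split; apply closure_plus; now apply closure_mult].
  intros x y. destruct (df x y) as [? []], (dg x y) as [? []].
  split; [now apply continuity_2d_pt_mult|split; auto_derive; auto].
- rewrite (scalar_field_ext _ _ (fun u v => D1_inv f u v df (f_neq0 u v))),
    (scalar_field_ext _ _ (fun u v => D2_inv f u v df (f_neq0 u v))).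
  split; [|split; repeat apply closure_mult; auto using closure_const, closure_inv].
  intros x y. destruct (df x y) as [? []].
  split; [now apply continuity_2d_pt_inv|split; auto_derive; auto].
Qed.

Lemma smooth_closure_smooth f : smooth_closure f -> smooth f.
Proof.
intros cf n. revert f cf.
induction n as [|n IH]; intros f cf x y;
  destruct (smooth_closure_step f cf) as [df [cf1 cf2]]; simpl;
  (split; [exact (proj1 (df x y))|]); [exact I|].
split; [|split; [|split]].
- now apply differentiable_ex_D1.
- now apply differentiable_ex_D2.
- exact (IH (D1 f) cf1 x y).
- exact (IH (D2 f) cf2 x y).
Qed.

Lemma smooth_D1 f : smooth f -> smooth (D1 f).
Proof. intros sf n x y. apply (sf (S n) x y). Qed.

Lemma smooth_D2 f : smooth f -> smooth (D2 f).
Proof. intros sf n x y. apply (sf (S n) x y). Qed.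

Lemma smooth_const c : smooth (fun _ _ => c).
Proof. apply smooth_closure_smooth, closure_const. Qed.

Lemma smooth_plus f g : smooth f -> smooth g -> smooth (fun x y => f x y + g x y).
Proof.
intros sf sg. apply smooth_closure_smooth, closure_plus; now apply closure_smooth.
Qed.

Lemma smooth_mult f g : smooth f -> smooth g -> smooth (fun x y => f x y * g x y).
Proof.
intros sf sg. apply smooth_closure_smooth, closure_mult; now apply closure_smooth.
Qed.

Lemma smooth_inv f : smooth f -> (forall x y, f x y <> 0) ->
  smooth (fun x y => / f x y).
Proof.
intros sf f_neq0. apply smooth_closure_smooth, closure_inv; [|exact f_neq0].
now apply closure_smooth.
Qed.

Lemma smooth_opp f : smooth f -> smooth (fun x y => - f x y).
Proof.
intros sf. replace (fun x y => - f x y) with (fun x y => (-1) * f x y)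
  by (apply scalar_field_ext; intros; ring).
apply (smooth_mult (fun _ _ => -1)); [apply smooth_const|exact sf].
Qed.

Lemma smooth_div f g : smooth f -> smooth g -> (forall x y, g x y <> 0) ->
  smooth (fun x y => f x y / g x y).
Proof. intros sf sg g_neq0. apply smooth_mult; [|apply smooth_inv]; auto. Qed.

Lemma smooth_pow f n : smooth f -> smooth (fun x y => f x y ^ n).
Proof.
intros sf. induction n as [|n IH]; simpl; [apply smooth_const|].
now apply smooth_mult.
Qed.

Lemma smooth_ex_D1 f x y : smooth f -> ex_derive (fun t => f t y) x.
Proof. intros sf. apply (sf 1%nat x y). Qed.

Lemma smooth_ex_D2 f x y : smooth f -> ex_derive (fun t => f x t) y.
Proof. intros sf. apply (sf 1%nat x y). Qed.

#[local] Hint Resolve smooth_D1 smooth_D2 smooth_const smooth_plus smooth_mult smooth_inv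
  smooth_opp smooth_div smooth_pow pow_nonzero : smooth.
#[local] Hint Resolve smooth_ex_D1 smooth_ex_D2 : smooth.

Lemma D1_D2_comm f x y : smooth f -> D1 (D2 f) x y = D2 (D1 f) x y.
Proof.
intros sf.
apply Schwarz.
- exists (mkposreal 1 Rlt_0_1). intros u v _ _.
  repeat split; auto with smooth.
  + now apply (smooth_ex_D1 (D2 f)), smooth_D2.
  + now apply (smooth_ex_D2 (D1 f)), smooth_D1.
- now apply (smooth_differentiable (D1 (D2 f))), smooth_D1, smooth_D2.
- now apply (smooth_differentiable (D2 (D1 f))), smooth_D2, smooth_D1.
Qed.

(** * Functions that are constant along an axis *)

Lemma derive_zero_const (f : R -> R) (x y : R) :
  (forall t, is_derive f t 0) -> f x = f y.
Proof.
intros df. destruct (Rtotal_order x y) as [lt|[->|gt]]; [|reflexivity|];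
  [|symmetry]; apply eq_is_derive; auto.
Qed.

Lemma D1_zero_const f x x' y : smooth f -> (forall t, D1 f t y = 0) ->
  f x y = f x' y.
Proof.
intros sf df. apply (derive_zero_const (fun t => f t y)). intro t.
rewrite <- (df t). apply Derive_correct. auto with smooth.
Qed.

Lemma D2_zero_const f x y y' : smooth f -> (forall t, D2 f x t = 0) ->
  f x y = f x y'.
Proof.
intros sf df. apply (derive_zero_const (fun t => f x t)). intro t.
rewrite <- (df t). apply Derive_correct. auto with smooth.
Qed.

Lemma only_x1_D2 f x y : only_x1 f -> D2 f x y = 0.
Proof.
intros of. unfold D2. rewrite (Derive_ext _ (fun _ => f x 0)); [apply Derive_const|].
intro t. apply of.
Qed.

Lemma only_x1_D1 f : only_x1 f -> only_x1 (D1 f).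
Proof. intros of x y y'. apply Derive_ext. intro t. apply of. Qed.

(** * Vector fields and the coordinate frame *)

Lemma vector_field_ext (X Y : vector_field) :
  (forall x y, dx1 X x y = dx1 Y x y) -> (forall x y, dx2 X x y = dx2 Y x y) ->
  X = Y.
Proof.
destruct X as [X1 X2], Y as [Y1 Y2]. intros e1 e2.
f_equal; now apply scalar_field_ext.
Qed.

Lemma smooth_d1 : smooth_vf d1.
Proof. split; [exact (smooth_const 1)|exact (smooth_const 0)]. Qed.

Lemma smooth_d2 : smooth_vf d2.
Proof. split; [exact (smooth_const 0)|exact (smooth_const 1)]. Qed.

#[local] Hint Resolve smooth_d1 smooth_d2 : smooth.

Lemma D1_inv_square f x y : smooth f -> f x y <> 0 ->
  D1 (fun x y => 1 / f x y ^ 2) x y = - 2 * D1 f x y / f x y ^ 3.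
Proof.
intros sf f_neq0'. unfold D1. apply is_derive_unique. auto_derive.
- repeat split; auto with smooth.
- field. exact f_neq0'.
Qed.

Lemma D2_inv_square f x y : only_x1 f -> D2 (fun x y => 1 / f x y ^ 2) x y = 0.
Proof.
intros of. apply (only_x1_D2 (fun x y => 1 / f x y ^ 2)). intros u v v'.
now rewrite (of u v v').
Qed.

Lemma lie_bracket_d1 X :
  lie_bracket d1 X = (D1 (dx1 X), D1 (dx2 X)).
Proof.
apply vector_field_ext; intros x y; unfold lie_bracket, deriv_along; simpl;
  rewrite ?D1_const, ?D2_const; ring.
Qed.

Lemma lie_bracket_d2 X :
  lie_bracket d2 X = (D2 (dx1 X), D2 (dx2 X)).
Proof.
apply vector_field_ext; intros x y; unfold lie_bracket, deriv_along; simpl;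
  rewrite ?D1_const, ?D2_const; ring.
Qed.

(** * Levi-Civita connection and Ricci operator *)

Section Connection.

Context (f1 f2 : scalar_field) (nabla : vector_field -> vector_field -> vector_field).
Context (f1_smooth : smooth f1) (f2_smooth : smooth f2).
Context (f1_neq0 : forall x y, f1 x y <> 0) (f2_neq0 : forall x y, f2 x y <> 0).
Context (f1_x1 : only_x1 f1) (f2_x1 : only_x1 f2).
Context (nabla_LC : is_levi_civita (metric f1 f2) nabla).

(** In these names the two lower indices come first and the upper one last; up to symmetry in the
    lower indices, the symbols not named vanish. *)
Definition christoffel111 : scalar_field := fun x y => - (D1 f1 x y / f1 x y).

Definition christoffel122 : scalar_field := fun x y => - (D1 f2 x y / f2 x y).

Definition christoffel221 : scalar_field :=
  fun x y => f1 x y ^ 2 * D1 f2 x y / f2 x y ^ 3.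

Lemma smooth_christoffel111 : smooth christoffel111.
Proof. unfold christoffel111. auto with smooth. Qed.

Lemma smooth_christoffel122 : smooth christoffel122.
Proof. unfold christoffel122. auto with smooth. Qed.

Lemma smooth_christoffel221 : smooth christoffel221.
Proof. unfold christoffel221. auto 7 with smooth. Qed.

Lemma metric_d1_d1 : metric f1 f2 d1 d1 = fun x y => 1 / f1 x y ^ 2.
Proof. apply scalar_field_ext. intros. unfold metric; simpl. field. auto. Qed.

Lemma metric_d1_d2 : metric f1 f2 d1 d2 = fun _ _ => 0.
Proof. apply scalar_field_ext. intros. unfold metric; simpl. field. auto. Qed.

Lemma metric_d2_d2 : metric f1 f2 d2 d2 = fun x y => 1 / f2 x y ^ 2.
Proof. apply scalar_field_ext. intros. unfold metric; simpl. field. auto. Qed.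

Lemma metric_compatible X Y Z x y : smooth_vf X -> smooth_vf Y -> smooth_vf Z ->
  deriv_along X (metric f1 f2 Y Z) x y
  = metric f1 f2 (nabla X Y) Z x y + metric f1 f2 Y (nabla X Z) x y.
Proof.
intros sX sY sZ. now rewrite (levi_civita_metric _ _ nabla_LC X Y Z).
Qed.

(** The coordinate fields have zero bracket, so this is absence of torsion. *)
Lemma nabla_d1_d2_comm : nabla d1 d2 = nabla d2 d1.
Proof.
assert (E := levi_civita_torsion_free _ _ nabla_LC d1 d2 smooth_d1 smooth_d2).
assert (E1 : forall x y, dx1 (vsub (nabla d1 d2) (nabla d2 d1)) x y = 0).
{ intros x y. rewrite E. unfold lie_bracket, deriv_along; simpl.
  rewrite !D1_const, !D2_const. ring. }
assert (E2 : forall x y, dx2 (vsub (nabla d1 d2) (nabla d2 d1)) x y = 0).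
{ intros x y. rewrite E. unfold lie_bracket, deriv_along; simpl.
  rewrite !D1_const, !D2_const. ring. }
apply vector_field_ext; intros x y;
  [specialize (E1 x y)|specialize (E2 x y)]; simpl in *; lra.
Qed.

(** Once [nabla d1 d2] and [nabla d2 d1] are identified, six components are unknown, and metric
    compatibility on coordinate fields gives six linear equations for them. *)
Lemma christoffel_symbols :
  nabla d1 d1 = (christoffel111, fun _ _ => 0) /\
  nabla d1 d2 = (fun _ _ => 0, christoffel122) /\
  nabla d2 d1 = (fun _ _ => 0, christoffel122) /\
  nabla d2 d2 = (christoffel221, fun _ _ => 0).
Proof.
assert (E : forall x y,
  (dx1 (nabla d1 d1) x y = christoffel111 x y /\ dx2 (nabla d1 d1) x y = 0) /\
  (dx1 (nabla d1 d2) x y = 0 /\ dx2 (nabla d1 d2) x y = christoffel122 x y) /\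
  (dx1 (nabla d2 d2) x y = christoffel221 x y /\ dx2 (nabla d2 d2) x y = 0)).
{ intros x y.
  assert (s1 := smooth_d1). assert (s2 := smooth_d2).
  assert (m111 := metric_compatible d1 d1 d1 x y s1 s1 s1).
  assert (m211 := metric_compatible d2 d1 d1 x y s2 s1 s1).
  assert (m122 := metric_compatible d1 d2 d2 x y s1 s2 s2).
  assert (m222 := metric_compatible d2 d2 d2 x y s2 s2 s2).
  assert (m112 := metric_compatible d1 d1 d2 x y s1 s1 s2).
  assert (m212 := metric_compatible d2 d1 d2 x y s2 s1 s2).
  rewrite metric_d1_d1 in m111. rewrite metric_d1_d1, <- nabla_d1_d2_comm in m211.
  rewrite metric_d2_d2 in m122. rewrite metric_d2_d2 in m222.
  rewrite metric_d1_d2 in m112. rewrite metric_d1_d2, <- nabla_d1_d2_comm in m212.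
  unfold deriv_along in m111, m211, m122, m222, m112, m212.
  rewrite D1_inv_square, ?D2_inv_square in m111 by auto.
  rewrite D1_inv_square, ?D2_inv_square in m211 by auto.
  rewrite D1_inv_square, ?D2_inv_square in m122 by auto.
  rewrite D1_inv_square, ?D2_inv_square in m222 by auto.
  rewrite D1_const, D2_const in m112. rewrite D1_const, D2_const in m212.
  unfold metric, christoffel111, christoffel122, christoffel221 in *.
  assert (n1 := f1_neq0 x y). assert (n2 := f2_neq0 x y).
  destruct (nabla d1 d1) as [G111 G112], (nabla d1 d2) as [G121 G122],
    (nabla d2 d2) as [G221 G222]; simpl dx1 in *; simpl dx2 in *.
  set (u := f1 x y) in *. set (v := f2 x y) in *.
  set (u' := D1 f1 x y) in *. set (v' := D1 f2 x y) in *.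
  (* The order matters: [m211], [m222], [m111] and [m122] each contain one unknown, while [m112]
     needs [e121] and [m212] needs [e122]. *)
  assert (e121 : G121 x y = 0).
  { apply (Rmult_eq_reg_l (/ u ^ 2)); [|now apply Rinv_neq_0_compat, pow_nonzero].
    lra. }
  assert (e222 : G222 x y = 0).
  { apply (Rmult_eq_reg_l (/ v ^ 2)); [|now apply Rinv_neq_0_compat, pow_nonzero].
    lra. }
  assert (e112 : G112 x y = 0).
  { apply (Rmult_eq_reg_l (/ v ^ 2)); [|now apply Rinv_neq_0_compat, pow_nonzero].
    rewrite e121 in m112. lra. }
  assert (e111 : G111 x y = - (u' / u)).
  { apply (Rmult_eq_reg_l (2 / u ^ 2)).
    - transitivity (-2 * u' / u ^ 3); [lra|now field].
    - apply Rmult_integral_contrapositive_currified; [lra|].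
      now apply Rinv_neq_0_compat, pow_nonzero. }
  assert (e122 : G122 x y = - (v' / v)).
  { apply (Rmult_eq_reg_l (2 / v ^ 2)).
    - transitivity (-2 * v' / v ^ 3); [lra|now field].
    - apply Rmult_integral_contrapositive_currified; [lra|].
      now apply Rinv_neq_0_compat, pow_nonzero. }
  repeat split; auto.
  rewrite e122 in m212. apply (Rmult_eq_reg_l (/ u ^ 2)).
  - transitivity (v' / v ^ 3); [|now field].
    replace (v' / v ^ 3) with (/ v ^ 2 * (v' / v)) by now field. lra.
  - now apply Rinv_neq_0_compat, pow_nonzero. }
rewrite <- nabla_d1_d2_comm. repeat split; apply vector_field_ext; intros; apply E.
Qed.

(** Expanding both arguments in [d1], [d2], linearity over functions on the left and the Leibniz
    rule on the right leave only the Christoffel symbols. *)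
Lemma nabla_coordinates X Y : smooth_vf X -> smooth_vf Y ->
  nabla X Y =
  (fun x y => deriv_along X (dx1 Y) x y + christoffel111 x y * (dx1 X x y * dx1 Y x y)
      + christoffel221 x y * (dx2 X x y * dx2 Y x y),
   fun x y => deriv_along X (dx2 Y) x y
      + christoffel122 x y * (dx1 X x y * dx2 Y x y + dx2 X x y * dx1 Y x y)).
Proof.
intros [sX1 sX2] [sY1 sY2].
assert (split_vf : forall Z, Z = vadd (vscal (dx1 Z) d1) (vscal (dx2 Z) d2)).
{ intros Z. apply vector_field_ext; intros x y; simpl; ring. }
assert (sV : forall f Z, smooth f -> smooth_vf Z -> smooth_vf (vscal f Z)).
{ intros f Z sf [sZ1 sZ2]. split; now apply smooth_mult. }
assert (sA : forall Z W, smooth_vf Z -> smooth_vf W -> smooth_vf (vadd Z W)).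
{ intros Z W [] []. split; now apply smooth_plus. }
assert (aff := levi_civita_affine _ _ nabla_LC).
destruct christoffel_symbols as [G11 [G12 [G21 G22]]].
assert (s1 := smooth_d1). assert (s2 := smooth_d2).
transitivity (nabla (vadd (vscal (dx1 X) d1) (vscal (dx2 X) d2))
  (vadd (vscal (dx1 Y) d1) (vscal (dx2 Y) d2))); [now f_equal|].
rewrite (connection_addl _ aff), !(connection_scall _ aff) by auto.
rewrite !(connection_addr _ aff) by auto.
rewrite !(connection_leibniz _ aff) by auto.
rewrite G11, G12, G21, G22.
apply vector_field_ext; intros x y; unfold deriv_along; simpl; ring.
Qed.

Lemma nabla_d1_right X : smooth_vf X ->
  nabla X d1 = (fun x y => christoffel111 x y * dx1 X x y,
                fun x y => christoffel122 x y * dx2 X x y).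
Proof.
intros sX. rewrite nabla_coordinates by auto with smooth.
apply vector_field_ext; intros x y; unfold deriv_along; simpl;
  rewrite ?D1_const, ?D2_const; ring.
Qed.

Lemma nabla_d2_right X : smooth_vf X ->
  nabla X d2 = (fun x y => christoffel221 x y * dx2 X x y,
                fun x y => christoffel122 x y * dx1 X x y).
Proof.
intros sX. rewrite nabla_coordinates by auto with smooth.
apply vector_field_ext; intros x y; unfold deriv_along; simpl;
  rewrite ?D1_const, ?D2_const; ring.
Qed.

(** * The Ricci tensor and the Ricci operator *)

Lemma christoffel111_D2 x y : D2 christoffel111 x y = 0.
Proof.
apply only_x1_D2. intros u v v'. unfold christoffel111.
now rewrite (f1_x1 u v v'), (only_x1_D1 _ f1_x1 u v v').
Qed.

Lemma christoffel122_D2 x y : D2 christoffel122 x y = 0.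
Proof.
apply only_x1_D2. intros u v v'. unfold christoffel122.
now rewrite (f2_x1 u v v'), (only_x1_D1 _ f2_x1 u v v').
Qed.

Lemma christoffel221_D2 x y : D2 christoffel221 x y = 0.
Proof.
apply only_x1_D2. intros u v v'. unfold christoffel221.
now rewrite (f1_x1 u v v'), (f2_x1 u v v'), (only_x1_D1 _ f2_x1 u v v').
Qed.

(** The curvature is tensorial, so the derivatives of the components of [X] cancel against the
    bracket term; the Christoffel symbols depend on the first variable only, so their [D2] drops
    out. *)
Lemma ricci_coordinates X x y : smooth_vf X ->
  ricci nabla X d1 x y =
    (christoffel111 x y * christoffel122 x y - D1 christoffel122 x y
     - christoffel122 x y ^ 2) * dx1 X x y /\
  ricci nabla X d2 x y =
    (D1 christoffel221 x y + christoffel111 x y * christoffel221 x y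
     - christoffel122 x y * christoffel221 x y) * dx2 X x y.
Proof.
intros [sX1 sX2].
assert (s111 := smooth_christoffel111). assert (s122 := smooth_christoffel122).
assert (s221 := smooth_christoffel221).
assert (sX : smooth_vf X) by now split.
assert (sL1 : smooth_vf (D1 (dx1 X), D1 (dx2 X))) by (split; now apply smooth_D1).
assert (sL2 : smooth_vf (D2 (dx1 X), D2 (dx2 X))) by (split; now apply smooth_D2).
assert (sP : forall f g h k, smooth f -> smooth g -> smooth h -> smooth k ->
  smooth_vf (fun x y => f x y * g x y, fun x y => h x y * k x y)).
{ intros. split; now apply smooth_mult. }
assert (sR : forall f, smooth f -> smooth_vf (f, fun _ _ => 0)).
{ intros. split; [assumption|exact (smooth_const 0)]. }
assert (sS : forall f, smooth f -> smooth_vf (fun _ _ => 0, f)).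
{ intros. split; [exact (smooth_const 0)|assumption]. }
destruct christoffel_symbols as [G11 [G12 [G21 G22]]].
assert (C111 := christoffel111_D2). assert (C122 := christoffel122_D2).
assert (C221 := christoffel221_D2).
unfold ricci, curvature. rewrite lie_bracket_d1, lie_bracket_d2, G11, G12, G21, G22.
rewrite !nabla_d1_right, !nabla_d2_right by assumption.
rewrite !nabla_coordinates by auto with smooth.
unfold deriv_along; simpl.
rewrite !D1_mult, !D2_mult by (apply smooth_differentiable; assumption).
rewrite ?C111, ?C122, ?C221, ?D1_const, ?D2_const.
split; ring.
Qed.

(* With this quantity [p], the orthonormal frame satisfies
   nabla_{E_2} E_1 = - p f2 E_2 and nabla_{E_2} E_2 = p f2 E_1. *)
Definition rotation_rate : scalar_field :=
  fun x y => f1 x y * D1 f2 x y / f2 x y ^ 2.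

Lemma smooth_rotation_rate : smooth rotation_rate.
Proof. unfold rotation_rate. auto with smooth. Qed.

Lemma only_x1_rotation_rate : only_x1 rotation_rate.
Proof.
intros x y y'. unfold rotation_rate.
now rewrite (f1_x1 x y y'), (f2_x1 x y y'), (only_x1_D1 _ f2_x1 x y y').
Qed.

(** With h = 1 / f2 one has p = - E_1 h, so this is - E_1 (E_1 h) / h, the classical curvature of
    ds^2 + h^2 dy^2. *)
Definition gauss_curvature : scalar_field :=
  fun x y => f1 x y * f2 x y * D1 rotation_rate x y.

(** The symbol equals - p f2 / f1; differentiating it in this form hides the second derivative of
    [f2] inside [D1 rotation_rate]. *)
Lemma D1_christoffel122 x y :
  D1 christoffel122 x y =
  - (D1 rotation_rate x y * f2 x y / f1 x y
     + rotation_rate x y * (D1 f2 x y * f1 x y - f2 x y * D1 f1 x y) / f1 x y ^ 2).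
Proof.
assert (s := smooth_rotation_rate).
replace christoffel122 with (fun x y => - (rotation_rate x y * f2 x y / f1 x y)).
- unfold D1 at 1. apply is_derive_unique. auto_derive.
  + repeat split; auto with smooth.
  + unfold D1. now field.
- apply scalar_field_ext. intros. unfold christoffel122, rotation_rate. now field.
Qed.

Lemma D1_christoffel221 x y :
  D1 christoffel221 x y =
  D1 rotation_rate x y * f1 x y / f2 x y
  + rotation_rate x y * (D1 f1 x y * f2 x y - f1 x y * D1 f2 x y) / f2 x y ^ 2.
Proof.
assert (s := smooth_rotation_rate).
replace christoffel221 with (fun x y => rotation_rate x y * f1 x y / f2 x y).
- unfold D1 at 1. apply is_derive_unique. auto_derive.
  + repeat split; auto with smooth.
  + unfold D1. now field.
- apply scalar_field_ext. intros. unfold christoffel221, rotation_rate. now field.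
Qed.

(** On a surface the Ricci tensor is the curvature times the metric. Pairing with [d1] and [d2]
    reads off the components of [Q X], as the metric is diagonal. *)
Lemma ricci_operator_eq Q X : is_ricci_operator (metric f1 f2) nabla Q ->
  smooth_vf X -> Q X = vscal gauss_curvature X.
Proof.
intros HQ sX. destruct (HQ X sX) as [_ gQ].
apply vector_field_ext; intros x y;
  destruct (ricci_coordinates X x y sX) as [R1 R2];
  [rewrite <- (gQ d1 smooth_d1), D1_christoffel122 in R1; clear R2; rename R1 into RX
  |rewrite <- (gQ d2 smooth_d2), D1_christoffel221 in R2; clear R1; rename R2 into RX];
  unfold metric, christoffel111, christoffel122, christoffel221 in RX;
  unfold vscal, gauss_curvature; simpl dx1 in *; simpl dx2 in *;
  (* The derivative of [rotation_rate] is named before [rotation_rate] is unfolded, so that [field]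
     treats it as an atom. *)
  set (dr := D1 rotation_rate x y) in *; unfold rotation_rate in RX;
  assert (n1 := f1_neq0 x y); assert (n2 := f2_neq0 x y).
- apply (Rmult_eq_reg_l (1 / f1 x y ^ 2)).
  + transitivity (1 / f1 x y ^ 2 * (dx1 (Q X) x y * 1)
      + 1 / f2 x y ^ 2 * (dx2 (Q X) x y * 0)); [ring|].
    rewrite RX. now field.
  + unfold Rdiv. rewrite Rmult_1_l. now apply Rinv_neq_0_compat, pow_nonzero.
- apply (Rmult_eq_reg_l (1 / f2 x y ^ 2)).
  + transitivity (1 / f1 x y ^ 2 * (dx1 (Q X) x y * 0)
      + 1 / f2 x y ^ 2 * (dx2 (Q X) x y * 1)); [ring|].
    rewrite RX. now field.
  + unfold Rdiv. rewrite Rmult_1_l. now apply Rinv_neq_0_compat, pow_nonzero.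
Qed.

(* The components of nabla_{E_i} V = gauss_curvature E_i, with a nonvanishing
   factor cancelled from each. *)
Definition ricci_system (V1 V2 : scalar_field) : Prop := forall x y,
  D1 V1 x y = f2 x y * D1 rotation_rate x y /\
  D2 V1 x y = - rotation_rate x y * V2 x y /\
  D1 V2 x y = 0 /\
  D2 V2 x y = rotation_rate x y * V1 x y + f1 x y * D1 rotation_rate x y.

(** Both sides of nabla_X V = Q X are linear over functions in X, so the equation amounts to its
    four components for [d1] and [d2]. *)
Lemma ricci_vector_field_iff Q V1 V2 : is_ricci_operator (metric f1 f2) nabla Q ->
  smooth V1 -> smooth V2 ->
  is_ricci_vector_field nabla Q
    (vadd (vscal V1 (frame1 f1)) (vscal V2 (frame2 f2))) <->
  ricci_system V1 V2.
Proof.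
intros HQ sV1 sV2.
set (V := ((fun x y => V1 x y * f1 x y), (fun x y => V2 x y * f2 x y)) : vector_field).
replace (vadd (vscal V1 (frame1 f1)) (vscal V2 (frame2 f2))) with V
  by (apply vector_field_ext; intros; simpl; ring).
assert (sV : smooth_vf V) by (split; now apply smooth_mult).
assert (df : forall f, smooth f -> differentiable_along_axes f)
  by apply smooth_differentiable.
(* Passing from the orthonormal to the coordinate frame produces terms in [D1 f1] and [D1 f2]; those
   along [dx1 X] cancel against [christoffel111] and [christoffel122]. *)
assert (nX : forall X x y, smooth_vf X ->
  dx1 (nabla X V) x y = f1 x y * (dx1 X x y * D1 V1 x y
    + dx2 X x y * (D2 V1 x y + rotation_rate x y * V2 x y)) /\
  dx2 (nabla X V) x y = f2 x y * (dx1 X x y * D1 V2 x y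
    + dx2 X x y * (D2 V2 x y - rotation_rate x y * V1 x y))).
{ intros X x y sX. rewrite nabla_coordinates by assumption.
  unfold deriv_along, V; simpl.
  rewrite !D1_mult, !D2_mult by auto.
  rewrite (only_x1_D2 f1), (only_x1_D2 f2) by assumption.
  unfold christoffel111, christoffel122, christoffel221, rotation_rate.
  assert (n1 := f1_neq0 x y). assert (n2 := f2_neq0 x y).
  split; field; auto. }
split.
- intros [_ HV] x y.
  assert (n1 := f1_neq0 x y). assert (n2 := f2_neq0 x y).
  destruct (nX d1 x y smooth_d1) as [e11 e12], (nX d2 x y smooth_d2) as [e21 e22].
  rewrite (HV d1 smooth_d1), (ricci_operator_eq _ _ HQ smooth_d1) in e11, e12.
  rewrite (HV d2 smooth_d2), (ricci_operator_eq _ _ HQ smooth_d2) in e21, e22.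
  unfold gauss_curvature in *. simpl in e11, e12, e21, e22.
  repeat split.
  + apply (Rmult_eq_reg_l (f1 x y)); lra.
  + apply (Rmult_eq_reg_l (f1 x y)); lra.
  + apply (Rmult_eq_reg_l (f2 x y)); lra.
  + apply (Rmult_eq_reg_l (f2 x y)); lra.
- intros HV. split; [assumption|]. intros X sX. rewrite (ricci_operator_eq _ _ HQ sX).
  apply vector_field_ext; intros x y; destruct (nX X x y sX) as [e1 e2];
    destruct (HV x y) as [h1 [h2 [h3 h4]]].
  + rewrite e1, h1, h2. unfold gauss_curvature; simpl. ring.
  + rewrite e2, h3, h4. unfold gauss_curvature; simpl. ring.
Qed.

End Connection.

(** * Solution of the system *)

Lemma cos_Rabs_mult c y : cos (Rabs c * y) = cos (c * y).
Proof.
unfold Rabs. destruct (Rcase_abs c); [|reflexivity].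
now rewrite Ropp_mult_distr_l_reverse, cos_neg.
Qed.

(** As sine is odd, replacing |c| by c costs a factor [sign c]. Together with [sign_square] this
    turns the formulas of [flat_case] into a rotation with signed speed c. *)
Lemma sin_Rabs_mult c y : c <> 0 -> sin (Rabs c * y) = sign c * sin (c * y).
Proof.
intros c_neq0. destruct (Rdichotomy c 0 c_neq0).
- rewrite Rabs_left, sign_eq_m1, Ropp_mult_distr_l_reverse, sin_neg by assumption. ring.
- rewrite Rabs_right, sign_eq_1 by lra. ring.
Qed.

Lemma sign_square c : c <> 0 -> sign c * sign c = 1.
Proof.
intros c_neq0. destruct (Rdichotomy c 0 c_neq0);
  [rewrite sign_eq_m1 by assumption|rewrite sign_eq_1 by assumption]; ring.
Qed.

(** In axes turning with angular velocity c the vector (u, v) has constant components; these are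
    [e1] and [e2], and sin^2 + cos^2 = 1 inverts the turn. *)
Lemma rotation_ode (u v : R -> R) (c : R) :
  (forall y, is_derive u y (- c * v y)) -> (forall y, is_derive v y (c * u y)) ->
  forall y, u y = u 0 * cos (c * y) - v 0 * sin (c * y) /\
    v y = v 0 * cos (c * y) + u 0 * sin (c * y).
Proof.
intros du dv y.
assert (du' : forall t : R, Derive (fun x : R => u x) t = - c * v t)
  by (intro; apply is_derive_unique, du).
assert (dv' : forall t : R, Derive (fun x : R => v x) t = c * u t)
  by (intro; apply is_derive_unique, dv).
assert (e1 : u y * cos (c * y) + v y * sin (c * y)
    = u 0 * cos (c * 0) + v 0 * sin (c * 0)).
{ apply (derive_zero_const (fun t => u t * cos (c * t) + v t * sin (c * t))).
  intro t. auto_derive.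
  - repeat split; eexists; eauto.
  - rewrite du', dv'. ring. }
assert (e2 : v y * cos (c * y) - u y * sin (c * y)
    = v 0 * cos (c * 0) - u 0 * sin (c * 0)).
{ apply (derive_zero_const (fun t => v t * cos (c * t) - u t * sin (c * t))).
  intro t. auto_derive.
  - repeat split; eexists; eauto.
  - rewrite du', dv'. ring. }
rewrite Rmult_0_r, cos_0, sin_0 in e1, e2.
assert (cs := sin2_cos2 (c * y)). unfold Rsqr in cs.
set (C := cos (c * y)) in *. set (S := sin (c * y)) in *.
split.
- transitivity (u y * (S * S + C * C)); [rewrite cs; ring|].
  transitivity ((u y * C + v y * S) * C - (v y * C - u y * S) * S); [ring|].
  rewrite e1, e2. ring.
- transitivity (v y * (S * S + C * C)); [rewrite cs; ring|].
  transitivity ((v y * C - u y * S) * C + (u y * C + v y * S) * S); [ring|].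
  rewrite e1, e2. ring.
Qed.

(** * Equivalence of the system with the radial and flat cases *)

Section RicciSystem.

Context (f1 f2 V1 V2 : scalar_field).
Context (f1_smooth : smooth f1) (f2_smooth : smooth f2).
Context (f1_neq0 : forall x y, f1 x y <> 0) (f2_neq0 : forall x y, f2 x y <> 0).
Context (f1_x1 : only_x1 f1) (f2_x1 : only_x1 f2).
Context (f2'_neq0 : forall x y, D1 f2 x y <> 0).
Context (V1_smooth : smooth V1) (V2_smooth : smooth V2).

Let p := rotation_rate f1 f2.

Lemma rotation_rate_neq0 x y : p x y <> 0.
Proof.
unfold p, rotation_rate. apply Rmult_integral_contrapositive_currified.
- now apply Rmult_integral_contrapositive_currified.
- now apply Rinv_neq_0_compat, pow_nonzero.
Qed.

(** The equation for [f1] solved for p, which makes p' explicit. *)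
Lemma radial_rotation_rate V0 k c : radial_case f1 f2 V1 V0 k c ->
  p = (fun x y => k / 2 + c / (2 * f2 x y ^ 2)).
Proof.
intros [_ [_ h]]. apply scalar_field_ext. intros x y.
unfold p, rotation_rate. rewrite h. field. auto.
Qed.

Lemma radial_ricci_system k c :
  radial_case f1 f2 V1 V2 k c -> ricci_system f1 f2 V1 V2.
Proof.
intros rad x y. assert (pE := radial_rotation_rate _ _ _ rad).
assert (eV1 : V1 = fun x y => c / f2 x y) by (apply scalar_field_ext, rad).
assert (eV2 : V2 = fun _ _ => 0) by (apply scalar_field_ext, rad).
assert (D1p : D1 p x y = - c * D1 f2 x y / f2 x y ^ 3).
{ rewrite pE. unfold D1 at 1. apply is_derive_unique. auto_derive.
  - repeat split; auto with smooth.
    apply Rmult_integral_contrapositive_currified; [lra|auto with smooth].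
  - unfold D1. field. auto. }
(* The last equation is settled with this form of p, free of k: then p V1 = c f1 f2' / f2^3 cancels
   f1 p'. *)
assert (pxy : p x y = f1 x y * D1 f2 x y / f2 x y ^ 2) by reflexivity.
fold p. rewrite D1p, eV2, D1_const, D2_const, eV1.
repeat split.
- unfold D1 at 1. apply is_derive_unique. auto_derive.
  + repeat split; auto with smooth.
  + unfold D1. field. auto.
- rewrite (only_x1_D2 (fun x y => c / f2 x y)); [ring|].
  intros u v v'. now rewrite (f2_x1 u v v').
- rewrite pxy. field. auto.
Qed.

(** The equation for [f1] says that p is the constant c; hence p' = 0 and the system only asks for a
    rotation in the second variable. *)
Lemma flat_ricci_system c c1 c2 : c <> 0 ->
  flat_case f1 f2 V1 V2 c c1 c2 -> ricci_system f1 f2 V1 V2.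
Proof.
intros c_neq0 [h1 [h2 h3]] x y.
assert (pE : p = fun _ _ => c).
{ apply scalar_field_ext. intros u v. unfold p, rotation_rate. rewrite h3. field. auto. }
assert (ss := sign_square c c_neq0).
assert (eV1 : V1 = fun x y => sign c * c2 * cos (c * y) - c1 * sin (c * y)).
{ apply scalar_field_ext. intros u v. rewrite h1, cos_Rabs_mult, sin_Rabs_mult by assumption.
  transitivity (sign c * c2 * cos (c * v) - c1 * (sign c * sign c) * sin (c * v));
    [ring|rewrite ss; ring]. }
assert (eV2 : V2 = fun x y => c1 * cos (c * y) + sign c * c2 * sin (c * y)).
{ apply scalar_field_ext. intros u v. rewrite h2, cos_Rabs_mult, sin_Rabs_mult by assumption.
  ring. }
fold p. rewrite pE, D1_const, eV1, eV2. unfold D1, D2.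
repeat split; apply is_derive_unique; auto_derive; auto; ring.
Qed.

Context (sys : ricci_system f1 f2 V1 V2).

(* Symmetry of second derivatives of [V1]: [D1 V1] depends on [x] only, while
   [D2 V1 = - p V2] and [D1 V2 = 0]. *)
Lemma rotation_rate_stationary x y : D1 p x y * V2 x y = 0.
Proof.
assert (sp : smooth p) by now apply smooth_rotation_rate.
assert (e : D1 (D2 V1) x y = 0).
{ rewrite D1_D2_comm by assumption.
  apply only_x1_D2. intros u v v'.
  rewrite (proj1 (sys u v)), (proj1 (sys u v')), (f2_x1 u v v').
  f_equal. now apply only_x1_D1, only_x1_rotation_rate. }
replace (D2 V1) with (fun x y => - p x y * V2 x y) in e
  by (apply scalar_field_ext; intros u v; symmetry; apply (sys u v)).
rewrite (D1_mult (fun x y => - p x y)) in e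
  by (apply smooth_differentiable; auto with smooth).
rewrite (proj1 (proj2 (proj2 (sys x y)))) in e.
replace (D1 (fun x y => - p x y) x y) with (- D1 p x y) in e; [lra|].
symmetry. apply Derive_opp.
Qed.

(** With V2 = 0 the last equation becomes p V1 + f1 p' = 0, which yields two first integrals in
    turn: V1 f2, then 2 p - c / f2^2. *)
Lemma radial_of_ricci_system : (forall x y, V2 x y = 0) ->
  exists k c, radial_case f1 f2 V1 V2 k c.
Proof.
intros V20. assert (sp : smooth p) by now apply smooth_rotation_rate.
assert (eD2 : forall x y, p x y * V1 x y + f1 x y * D1 p x y = 0).
{ intros x y. transitivity (D2 V2 x y); [symmetry; apply (sys x y)|].
  unfold D2. rewrite (Derive_ext _ (fun _ => 0)); [apply Derive_const|auto]. }
assert (V1y : forall x y y', V1 x y = V1 x y').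
{ intros x y y'. apply D2_zero_const; [assumption|]. intro t.
  rewrite (proj1 (proj2 (sys x t))), V20. ring. }
(* The value of the first integral V1 f2 at the origin; it may be 0. *)
set (c := V1 0 0 * f2 0 0).
assert (eV1 : forall x y, V1 x y = c / f2 x y).
{ intros x y. apply (Rmult_eq_reg_r (f2 x y)); [|auto].
  transitivity c; [|field; auto]. unfold c.
  rewrite (V1y x y 0), (f2_x1 x y 0).
  apply (D1_zero_const (fun x y => V1 x y * f2 x y)); [auto with smooth|].
  intro t. rewrite D1_mult by (apply smooth_differentiable; assumption).
  apply (Rmult_eq_reg_l (f1 t 0)); [|auto].
  assert (e := eD2 t 0). rewrite (proj1 (sys t 0)). fold p.
  (* Since p f2^2 = f1 f2', f1 times the derivative of V1 f2 is f2^2 (p V1 + f1 p'). *)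
  transitivity (f2 t 0 ^ 2 * (p t 0 * V1 t 0 + f1 t 0 * D1 p t 0)); [|rewrite e; ring].
  replace (p t 0) with (f1 t 0 * D1 f2 t 0 / f2 t 0 ^ 2) by reflexivity.
  field. auto. }
(* The value at the origin of the second first integral; f1 times its derivative is 2 (p V1 + f1 p')
   with V1 = c / f2. *)
set (k := 2 * p 0 0 - c / f2 0 0 ^ 2).
exists k, c. split; [exact eV1|split; [exact V20|]].
intros x y. rewrite (f1_x1 x y 0), (f2_x1 x y 0), (only_x1_D1 _ f2_x1 x y 0).
assert (ek : 2 * p x 0 - c / f2 x 0 ^ 2 = k).
{ apply (D1_zero_const (fun x y => 2 * p x y - c / f2 x y ^ 2)).
  - assert (s : smooth (fun x y => c / f2 x y ^ 2))
      by (apply (smooth_div (fun _ _ => c)); auto with smooth).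
    unfold Rminus. apply (smooth_plus (fun x y => 2 * p x y));
      [apply (smooth_mult (fun _ _ => 2)); auto with smooth|now apply smooth_opp].
  - intro t. assert (e := eD2 t 0). rewrite eV1 in e.
    apply (Rmult_eq_reg_l (f1 t 0)); [|auto].
    unfold D1. transitivity (2 * (f1 t 0 * D1 p t 0)
      + 2 * c * (f1 t 0 * D1 f2 t 0 / f2 t 0 ^ 2) / f2 t 0).
    + rewrite (is_derive_unique _ t (2 * D1 p t 0 + 2 * c * D1 f2 t 0 / f2 t 0 ^ 3)).
      * field. auto.
      * auto_derive.
        -- repeat split; auto with smooth.
        -- unfold D1. field. auto.
    + change (f1 t 0 * D1 f2 t 0 / f2 t 0 ^ 2) with (p t 0).
      transitivity (2 * (p t 0 * (c / f2 t 0) + f1 t 0 * D1 p t 0)); [|rewrite e; ring].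
      field. auto. }
rewrite <- ek. unfold p, rotation_rate. field. auto.
Qed.

(** As D1 V2 = 0, V2 is nonzero on the whole line through (x0, y0) along the first axis. There
    [rotation_rate_stationary] forces p' = 0, and p depends on the first variable only, so it is
    constant everywhere. *)
Lemma flat_of_ricci_system x0 y0 : V2 x0 y0 <> 0 ->
  exists c c1 c2, c <> 0 /\ flat_case f1 f2 V1 V2 c c1 c2.
Proof.
intros V20. assert (sp : smooth p) by now apply smooth_rotation_rate.
assert (op : only_x1 p) by now apply only_x1_rotation_rate.
assert (D1p : forall x y, D1 p x y = 0).
{ intros x y. rewrite (only_x1_D1 _ op x y y0).
  destruct (Rmult_integral _ _ (rotation_rate_stationary x y0)) as [e|e]; [exact e|].
  exfalso. apply V20. rewrite <- e. apply D1_zero_const; [assumption|].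
  intro t. apply (sys t y0). }
set (c := p 0 0).
assert (pc : forall x y, p x y = c).
{ intros x y. unfold c. rewrite (op x y 0). now apply D1_zero_const. }
assert (c_neq0 : c <> 0) by apply rotation_rate_neq0.
assert (ss := sign_square c c_neq0).
assert (V1x : forall x y, V1 x y = V1 0 y).
{ intros x y. apply D1_zero_const; [assumption|]. intro t.
  rewrite (proj1 (sys t y)). fold p. rewrite D1p. ring. }
assert (V2x : forall x y, V2 x y = V2 0 y).
{ intros x y. apply D1_zero_const; [assumption|]. intro t. apply (sys t y). }
assert (rot : forall y, V1 0 y = V1 0 0 * cos (c * y) - V2 0 0 * sin (c * y) /\
    V2 0 y = V2 0 0 * cos (c * y) + V1 0 0 * sin (c * y)).
{ apply (rotation_ode (V1 0) (V2 0) c); intro y; destruct (sys 0 y) as [_ [e1 [_ e2]]];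
    fold p in e1, e2; rewrite pc in e1, e2.
  - rewrite <- e1. apply Derive_correct. auto with smooth.
  - rewrite D1p in e2. replace (c * V1 0 y) with (D2 V2 0 y) by lra.
    apply Derive_correct. auto with smooth. }
(* At the origin the flat formulas read V2 = c1 and V1 = sign(c) c2, and sign(c)^2 = 1. *)
exists c, (V2 0 0), (sign c * V1 0 0).
split; [exact c_neq0|split; [|split]]; intros x y.
- rewrite V1x, (proj1 (rot y)), cos_Rabs_mult, sin_Rabs_mult by assumption.
  transitivity ((sign c * sign c) * (V1 0 0 * cos (c * y) - V2 0 0 * sin (c * y)));
    [rewrite ss|]; ring.
- rewrite V2x, (proj2 (rot y)), cos_Rabs_mult, sin_Rabs_mult by assumption.
  transitivity (V2 0 0 * cos (c * y) + (sign c * sign c) * V1 0 0 * sin (c * y));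
    [rewrite ss|]; ring.
- rewrite <- (pc x y). unfold p, rotation_rate. field. auto.
Qed.

(* Here [k] cannot vanish, as [2 * f1 * D1 f2 = k * f2 ^ 2]; the zero field is thus
   the flat case with [c1 = c2 = 0] and rotation speed [k / 2]. *)
Lemma radial_zero_flat k : radial_case f1 f2 V1 V2 k 0 ->
  k / 2 <> 0 /\ flat_case f1 f2 V1 V2 (k / 2) 0 0.
Proof.
intros [h1 [h2 h3]]. split; [|split; [|split]].
- intro e. apply (f1_neq0 0 0). rewrite h3. replace k with 0 by lra. field. auto.
- intros x y. rewrite h1. field. auto.
- intros x y. rewrite h2. ring.
- intros x y. rewrite h3. field. auto.
Qed.

End RicciSystem.

Theorem theorem2p6
    (f1 f2 V1 V2 : scalar_field)
    (nabla : vector_field -> vector_field -> vector_field)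
    (Q : vector_field -> vector_field)
    (f1_smooth : smooth f1) (f2_smooth : smooth f2)
    (f1_neq0 : forall x y : R, f1 x y <> 0)
    (f2_neq0 : forall x y : R, f2 x y <> 0)
    (f1_x1 : only_x1 f1) (f2_x1 : only_x1 f2)
    (f2'_neq0 : forall x y : R, D1 f2 x y <> 0)
    (nabla_LC : is_levi_civita (metric f1 f2) nabla)
    (Q_ricci : is_ricci_operator (metric f1 f2) nabla Q)
    (V1_smooth : smooth V1) (V2_smooth : smooth V2) :
  is_ricci_vector_field nabla Q
    (vadd (vscal V1 (frame1 f1)) (vscal V2 (frame2 f2)))
  <->
  (exists k c : R, c <> 0 /\ radial_case f1 f2 V1 V2 k c)
  \/
  (exists c c1 c2 : R, c <> 0 /\ flat_case f1 f2 V1 V2 c c1 c2).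
Proof.
rewrite (ricci_vector_field_iff f1 f2 nabla) by assumption.
split.
- intros sys.
  destruct (classic (forall x y, V2 x y = 0)) as [V20|V2_neq0].
  + destruct (radial_of_ricci_system f1 f2 V1 V2) as [k [c rad]]; try assumption.
    destruct (Req_dec c 0) as [->|c_neq0]; [right|left; now exists k, c].
    exists (k / 2), 0, 0. now apply radial_zero_flat.
  + right. apply not_all_ex_not in V2_neq0 as [x0 V2_neq0].
    apply not_all_ex_not in V2_neq0 as [y0 V2_neq0].
    now apply (flat_of_ricci_system f1 f2 V1 V2) with x0 y0.
- intros [[k [c [_ rad]]]|[c [c1 [c2 [c_neq0 flat]]]]].
  + now apply (radial_ricci_system f1 f2 V1 V2) with k c.
  + now apply (flat_ricci_system f1 f2 V1 V2) with c c1 c2.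
Qed.
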